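(* Let $G=\mathbb{Z}^2*\mathbb{Z}$ and $P=\mathbb{N}^2*\mathbb{N}$. Then $(G,P)$ strongly reduces to an amenable group.
   Context: $\mathbb{N}=\{0,1,2,\dots\}$. $\mathbb{N}^2*\mathbb{N}$ denotes the submonoid of the free product $\mathbb{Z}^2*\mathbb{Z}$ generated by the embedded copies of $\mathbb{N}^2$ and $\mathbb{N}$. A positive cone in a group $G$ is a submonoid $P$ with $P\cap P^{-1}=\{1\}$; an ordered group $(G,P)$ is a group with a positive cone. An order homomorphism $\varphi:(G,P)\to(H,Q)$ is a group homomorphism $G\to H$ with $\varphi(P)\subseteq Q$; it is a strong reduction if $\varphi|_P:P\to Q$ is a bijection. $(G,P)$ strongly reduces to an amenable group if there are a (discrete) amenable group $H$, a positive cone $Q\subset H$, and a strong reduction $\varphi:(G,P)\to(H,Q)$. *)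

(* Defs.v *)
From HB Require Import structures.
From mathcomp Require Import all_boot all_order all_algebra.
From mathcomp Require Import all_classical all_reals all_analysis.

Set Implicit Arguments.
Unset Strict Implicit.
Unset Printing Implicit Defensive.

Import Order.TTheory GRing.Theory Num.Theory.
Import numFieldNormedType.Exports.

Local Open Scope classical_set_scope.
Local Open Scope quotient_scope.
Local Open Scope group_scope.

Definition submonoid (G : groupType) (P : set G) : Prop :=
  P 1 /\ forall x y, P x -> P y -> P (x * y).

Definition positive_cone (G : groupType) (P : set G) : Prop :=
  submonoid P /\ P `&` [set x^-1 | x in P] = [set 1].

Record orderedGroup := OrderedGroup {
  og_group :> groupType;
  cone : set og_group;
  coneP : positive_cone cone }.
Arguments cone : clear implicits.
Arguments coneP : clear implicits.

Definition order_hom (G H : orderedGroup) (f : {multiplicative G -> H}) : Prop :=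
  f @` cone G `<=` cone H.

Definition strong_reduction (G H : orderedGroup) (f : {multiplicative G -> H}) :
    Prop :=
  order_hom f /\ set_bij (cone G) (cone H) f.

Section Amenable.
Local Open Scope ring_scope.

(* A left-invariant mean on the bounded real functions on H; the values of [m] on
   unbounded functions are unconstrained. *)
Definition left_invariant_mean (R : realType) (H : groupType)
    (m : (H -> R^o) -> R) : Prop :=
  [/\ forall (a b : R) (f g : H -> R^o), bounded_fun f -> bounded_fun g ->
        m (fun x => a * f x + b * g x) = a * m f + b * m g,
      forall f : H -> R^o, bounded_fun f -> (forall x, 0 <= f x) -> 0 <= m f,
      m (fun=> 1) = 1 &
      forall (h : H) (f : H -> R^o), bounded_fun f ->
        m (fun x => f (h^-1 * x)%g) = m f].

Definition amenable (R : realType) (H : groupType) : Prop :=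
  exists m : (H -> R^o) -> R, left_invariant_mean m.

End Amenable.

Definition strongly_reduces_to_amenable (R : realType) (G : orderedGroup) :
    Prop :=
  exists H : orderedGroup,
    amenable R H /\ exists f : {multiplicative G -> H}, strong_reduction f.

(* The free product A * B: words in A + B modulo the congruence which identifies
   juxtaposition of two letters of the same factor with their product, and the
   unit of each factor with the empty word. *)

Section FreeProduct.
Variables A B : groupType.

Inductive fpeq : seq (A + B) -> seq (A + B) -> Prop :=
| fpeq_refl s : fpeq s s
| fpeq_sym s t : fpeq s t -> fpeq t s
| fpeq_trans s t u : fpeq s t -> fpeq t u -> fpeq s u
| fpeq_cat s s' t t' : fpeq s s' -> fpeq t t' -> fpeq (s ++ t) (s' ++ t')
| fpeq_1l : fpeq [:: inl 1] [::]
| fpeq_1r : fpeq [:: inr 1] [::]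
| fpeq_Ml a a' : fpeq [:: inl a; inl a'] [:: inl (a * a')]
| fpeq_Mr b b' : fpeq [:: inr b; inr b'] [:: inr (b * b')].

Definition fpeqb (s t : seq (A + B)) : bool := `[< fpeq s t >].

Lemma fpeqb_refl : reflexive fpeqb.
Proof. by move=> s; apply/asboolP; exact: fpeq_refl. Qed.

Lemma fpeqb_sym : symmetric fpeqb.
Proof. by move=> s t; apply/asboolP/asboolP => /fpeq_sym. Qed.

Lemma fpeqb_trans : transitive fpeqb.
Proof.
move=> t s u /asboolP st /asboolP tu; apply/asboolP; exact: fpeq_trans st tu.
Qed.

Canonical fpeqb_equiv := EquivRel fpeqb fpeqb_refl fpeqb_sym fpeqb_trans.

Definition freeProd : Type := {eq_quot fpeqb}.
HB.instance Definition _ := Choice.on freeProd.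

Definition fp_class (s : seq (A + B)) : freeProd := \pi_({eq_quot fpeqb}) s.
Definition fp_repr (x : freeProd) : seq (A + B) := repr (x : {eq_quot fpeqb}).

Lemma fp_reprK x : fp_class (fp_repr x) = x.
Proof. exact: reprK. Qed.

Lemma fp_classP s t : fp_class s = fp_class t <-> fpeq s t.
Proof.
split=> [/eqmodP /asboolP //|st].
by apply/eqmodP; apply/asboolP.
Qed.

Lemma fp_repr_class s : fpeq (fp_repr (fp_class s)) s.
Proof. by apply/fp_classP; rewrite fp_reprK. Qed.

Definition letter_inv (l : A + B) : A + B :=
  match l with inl a => inl a^-1 | inr b => inr b^-1 end.
Definition word_inv (s : seq (A + B)) := rev (map letter_inv s).

Lemma letter_invK : involutive letter_inv.
Proof. by case=> x /=; rewrite invgK. Qed.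

Lemma word_invK : involutive word_inv.
Proof. by move=> s; rewrite /word_inv map_rev revK mapK //; exact: letter_invK. Qed.

Lemma word_invV s : fpeq (word_inv s ++ s) [::].
Proof.
elim: s => [|l s IH]; first exact: fpeq_refl.
rewrite /word_inv /= rev_cons -/(word_inv s) cat_rcons.
apply: fpeq_trans IH; apply: fpeq_cat (fpeq_refl _) _.
rewrite -[l :: s]/([:: l] ++ s) -cat_cons -{2}[s]cat0s.
apply: fpeq_cat (fpeq_refl _).
case: l => x /=.
- apply: fpeq_trans (fpeq_Ml _ _) _; rewrite mulVg; exact: fpeq_1l.
- apply: fpeq_trans (fpeq_Mr _ _) _; rewrite mulVg; exact: fpeq_1r.
Qed.

Lemma word_inv_eq s t : fpeq s t -> fpeq (word_inv s) (word_inv t).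
Proof.
move=> st.
apply: (@fpeq_trans _ (word_inv s ++ (t ++ word_inv t))).
  rewrite -[X in fpeq X _]cats0; apply: fpeq_cat (fpeq_refl _) _.
  apply: fpeq_sym; rewrite -{1}[t]word_invK; exact: word_invV.
rewrite catA -[X in fpeq _ X]cat0s; apply: fpeq_cat (fpeq_refl _).
apply: fpeq_trans (word_invV s); apply: fpeq_cat (fpeq_refl _) _.
exact: fpeq_sym.
Qed.

Definition fp_mul (x y : freeProd) := fp_class (fp_repr x ++ fp_repr y).
Definition fp_one := fp_class [::].
Definition fp_inv (x : freeProd) := fp_class (word_inv (fp_repr x)).

Lemma fp_mulE s t : fp_mul (fp_class s) (fp_class t) = fp_class (s ++ t).
Proof. by apply/fp_classP; apply: fpeq_cat; exact: fp_repr_class. Qed.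

Lemma fp_invE s : fp_inv (fp_class s) = fp_class (word_inv s).
Proof. by apply/fp_classP; apply: word_inv_eq; exact: fp_repr_class. Qed.

Lemma fp_mulA : associative fp_mul.
Proof.
move=> x y z; rewrite -[x]fp_reprK -[y]fp_reprK -[z]fp_reprK.
by rewrite !fp_mulE catA.
Qed.

Lemma fp_mul1 : left_id fp_one fp_mul.
Proof. by move=> x; rewrite -[x]fp_reprK /fp_one fp_mulE. Qed.

Lemma fp_mulr1 : right_id fp_one fp_mul.
Proof. by move=> x; rewrite -[x]fp_reprK /fp_one fp_mulE cats0. Qed.

Lemma fp_mulV : left_inverse fp_one fp_inv fp_mul.
Proof.
move=> x; rewrite -[x]fp_reprK fp_invE fp_mulE.
by apply/fp_classP; exact: word_invV.
Qed.

Lemma fp_mulrV : right_inverse fp_one fp_inv fp_mul.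
Proof.
move=> x; rewrite -[x]fp_reprK fp_invE fp_mulE.
by apply/fp_classP; rewrite -{1}[fp_repr x]word_invK; exact: word_invV.
Qed.

HB.instance Definition _ :=
  isGroup.Build freeProd fp_mulA fp_mul1 fp_mulr1 fp_mulV fp_mulrV.

Definition fp_inl (a : A) : freeProd := fp_class [:: inl a].
Definition fp_inr (b : B) : freeProd := fp_class [:: inr b].

Lemma fp_inlM : {morph fp_inl : x y / x * y}.
Proof.
move=> x y; rewrite [RHS]fp_mulE; apply/fp_classP/fpeq_sym; exact: fpeq_Ml.
Qed.

Lemma fp_inrM : {morph fp_inr : x y / x * y}.
Proof.
move=> x y; rewrite [RHS]fp_mulE; apply/fp_classP/fpeq_sym; exact: fpeq_Mr.
Qed.

HB.instance Definition _ := isMultiplicative.Build A freeProd fp_inl fp_inlM.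
HB.instance Definition _ := isMultiplicative.Build B freeProd fp_inr fp_inrM.

Section UniversalProperty.
Variables (K : groupType) (f : {multiplicative A -> K})
  (g : {multiplicative B -> K}).

Definition word_lift (s : seq (A + B)) : K :=
  foldr (fun l k => match l with inl a => f a | inr b => g b end * k) 1 s.

Lemma word_lift_cat s t : word_lift (s ++ t) = word_lift s * word_lift t.
Proof. by elim: s => [|l s IH] /=; rewrite ?mul1g // IH mulgA. Qed.

Lemma word_lift_eq s t : fpeq s t -> word_lift s = word_lift t.
Proof.
elim=> {s t} //=.
- by move=> s t u _ -> _ ->.
- by move=> s s' t t' _ Hs _ Ht; rewrite !word_lift_cat Hs Ht.
- by rewrite mulg1; apply: (@mulgI _ (f 1)); rewrite -gmulfM !mulg1.
- by rewrite mulg1; apply: (@mulgI _ (g 1)); rewrite -gmulfM !mulg1.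
- by move=> a a'; rewrite gmulfM !mulg1.
- by move=> b b'; rewrite gmulfM !mulg1.
Qed.

Definition fp_lift (x : freeProd) : K := word_lift (fp_repr x).

Lemma fp_liftE s : fp_lift (fp_class s) = word_lift s.
Proof. by apply: word_lift_eq; exact: fp_repr_class. Qed.

Lemma fp_liftM : {morph fp_lift : x y / x * y}.
Proof.
move=> x y; rewrite -[x]fp_reprK -[y]fp_reprK [X in fp_lift X]fp_mulE.
by rewrite !fp_liftE word_lift_cat.
Qed.

HB.instance Definition _ := isMultiplicative.Build freeProd K fp_lift fp_liftM.

Lemma fp_lift_inl a : fp_lift (fp_inl a) = f a.
Proof. by rewrite fp_liftE /= mulg1. Qed.

Lemma fp_lift_inr b : fp_lift (fp_inr b) = g b.
Proof. by rewrite fp_liftE /= mulg1. Qed.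

Lemma fp_lift_unique (h : {multiplicative freeProd -> K}) :
  (forall a, h (fp_inl a) = f a) -> (forall b, h (fp_inr b) = g b) ->
  h =1 fp_lift.
Proof.
move=> hl hr x; rewrite -[x]fp_reprK fp_liftE.
elim: (fp_repr x) => [|l s IH] /=.
  by apply: (@mulgI _ (h 1)); rewrite -gmulfM !mulg1.
rewrite -IH -[l :: s]/([:: l] ++ s) -fp_mulE [h (fp_mul _ _)]gmulfM.
by case: l => ?; rewrite ?[h _]hl ?[h _]hr.
Qed.

End UniversalProperty.

Definition fp_submonoid (S : set A) (T : set B) : set freeProd :=
  smallest (@submonoid freeProd) (fp_inl @` S `|` fp_inr @` T).

End FreeProduct.

(* The additive group of integers, written multiplicatively. *)
Definition Zm : groupType := Algebra.to_multiplicative int.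
Definition Z2 : groupType := (Zm * Zm)%type.

Definition Nset : set Zm := [set n | (0 <= (n : int))%R].
Definition N2set : set Z2 := Nset `*` Nset.

Definition Z2_Z : groupType := freeProd Z2 Zm.
Definition N2_N : set Z2_Z := fp_submonoid N2set Nset.

Definition sum2 (p : Z2) : Zm := p.1 * p.2.

Lemma sum2M : {morph sum2 : p q / p * q}.
Proof. move=> p q; exact: (@addrACA int). Qed.

HB.instance Definition _ := isMultiplicative.Build Z2 Zm sum2 sum2M.

Definition degree : {multiplicative Z2_Z -> Zm} :=
  @fp_lift Z2 Zm Zm sum2 idfun.

Lemma N2_N_submonoid : submonoid N2_N.
Proof.
split=> [M [[M1 _] _] //|x y Nx Ny M MP].
by apply: MP.1.2; [exact: Nx|exact: Ny].
Qed.

Lemma N2_N_degree x : N2_N x -> x = 1 \/ (0 < (degree x : int))%R.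
Proof.
move: x; suff: N2_N `<=` [set x | x = 1 \/ (0 < (degree x : int))%R] by [].
apply: smallest_sub; first split; first by left.
- move=> x y [-> |x0] [-> |y0]; rewrite /= ?mul1g ?mulg1; [by left|by right..|].
  by right; rewrite [degree _]gmulfM; exact: (@addr_gt0 int).
- move=> _ [[p [p1 p2] <-]|[n n0 <-]] /=.
  + rewrite [degree _]fp_lift_inl.
    have [p0|p0] := eqVneq p 1.
      by left; rewrite p0; apply/fp_classP; exact: fpeq_1l.
    right; rewrite lt_neqAle; apply/andP; split; last exact: (@addr_ge0 int).
    apply: contra_neq p0 => /esym /eqP.
    rewrite [_ == _](@paddr_eq0 int) // => /andP[/eqP q1 /eqP q2].
    by case: p q1 q2 {p1 p2} => ? ? /= -> ->.
  + rewrite [degree _]fp_lift_inr /=.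
    have [n1|n1] := eqVneq n 1.
      by left; rewrite n1; apply/fp_classP; exact: fpeq_1r.
    by right; rewrite lt_neqAle eq_sym n1.
Qed.

Lemma N2_N_cone : positive_cone N2_N.
Proof.
split; first exact: N2_N_submonoid.
apply/seteqP; split=> [x [/N2_N_degree [//|x0] [y Ny yx]]|_ ->]; last first.
  split; first exact: N2_N_submonoid.1.
  by exists 1; [exact: N2_N_submonoid.1|rewrite invg1].
case: (N2_N_degree Ny) => [y1|y0]; first by rewrite -yx y1 /= invg1.
suff: (0 < (degree (x * y)%g : int))%R.
  rewrite -yx mulVg (_ : degree 1 = 1 :> Zm) ?ltxx //.
  by apply: (@mulgI _ (degree 1)); rewrite -gmulfM !mulg1.
by rewrite [degree _]gmulfM; exact: (@addr_gt0 int).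
Qed.

(* Main.v *)
(* A positive word p_0 c p_1 c ... c p_k of N^2 * N, with p_i in N^2 and c the
   generator of the factor N, is sent to the element of the wreath product
   Z^2 wr Z whose lamp at position i is p_i and whose cursor is at k; the word can
   be read off from this element, so the morphism induced by c |-> shift and
   p |-> lamp p at 0 is injective on N^2 * N. The wreath product is an extension of
   an abelian group by Z, hence amenable. A mean on an abelian group is an
   ultrafilter limit of averages over boxes {g_1^i_1 ... g_n^i_n | i_j <= N}. *)

From HB Require Import structures.
From mathcomp Require Import all_boot all_order all_algebra.
From mathcomp Require Import all_classical all_reals all_analysis.
From mathcomp Require Import zify lra.
Require Import Defs.

Set Implicit Arguments.
Unset Strict Implicit.
Unset Printing Implicit Defensive.

Import Order.TTheory GRing.Theory Num.Theory.
Import numFieldNormedType.Exports.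

Local Open Scope classical_set_scope.
Local Open Scope ring_scope.

(** * Bounded real functions and limits along ultrafilters *)

Lemma bounded_funP (T : Type) (R : realType) (f : T -> R^o) :
  bounded_fun f <-> exists B : R, forall x, `|f x| <= B.
Proof.
split=> [[M [_ fM]]|[B fB]].
  exists (M + 1) => x; apply: fM => //; by rewrite ltrDl.
exists B; split; first exact: num_real.
by move=> M BM x _; apply: le_trans (fB x) (ltW BM).
Qed.

Lemma ultra_fmap (T U : Type) (f : T -> U) (F : set_system T) :
  UltraFilter F -> UltraFilter (f @ F).
Proof.
move=> FU; have FF := @ultra_proper _ _ FU; split.
  exact: fmap_proper_filter.
move=> G GG fFG; apply/seteqP; split => // A GA.
have [//|nA] := in_ultra_setVsetC (f @^-1` A) FU.
case: (@filter_not_empty _ G _); rewrite -(setICr A).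
by apply: filterI => //; exact: fFG.
Qed.

(** The image of [F] is an ultrafilter containing the segment from [- B] to [B], so compactness
    gives it a limit. *)
Lemma cvg_ultra_bounded (T : Type) (R : realType) (F : set_system T)
    (f : T -> R^o) : UltraFilter F -> bounded_fun f -> cvg (f @ F).
Proof.
move=> FU /bounded_funP[B fB].
have := @segment_compact R (- B) B; rewrite compact_ultra.
move=> /(_ _ (ultra_fmap f FU)) [|l [_ fl]]; last by apply/cvg_ex; exists l.
have FF := @ultra_proper _ _ FU; apply: (@filterE _ F) => x /=.
by rewrite in_itv /= -ler_norml.
Qed.

(** * Box averages and invariant means on abelian groups *)

Section Average.
Variables (R : realType) (G : groupType).
Implicit Types (N : nat) (g h x : G) (s : seq G) (f : G -> R^o).

Definition avg N g f : G -> R^o :=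
  fun x => N.+1%:R^-1 * \sum_(i < N.+1) f (g ^+ i * x)%g.

Definition avgs N s f : G -> R^o := foldr (avg N) f s.

Lemma avgs_linear N s a b f f' x :
  avgs N s (fun x => a * f x + b * f' x) x
  = a * avgs N s f x + b * avgs N s f' x.
Proof.
elim: s x => //= g s IH x; rewrite {1}/avg; under eq_bigr do rewrite IH.
by rewrite big_split -!mulr_sumr mulrDr !(mulrCA N.+1%:R^-1).
Qed.

Lemma avgs_cst N s (c : R) x : avgs N s (fun=> c) x = c.
Proof.
elim: s x => //= g s IH x; rewrite {1}/avg; under eq_bigr do rewrite IH.
by rewrite sumr_const card_ord -[c *+ _]mulr_natl mulKf// pnatr_eq0.
Qed.

Lemma avgs_ge0 N s f x : (forall y, 0 <= f y) -> 0 <= avgs N s f x.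
Proof.
move=> f0; elim: s x => //= g s IH x.
by apply: mulr_ge0; rewrite ?invr_ge0 ?ler0n //; apply: sumr_ge0.
Qed.

Lemma avgs_bound N s f (B : R) x :
  (forall y, `|f y| <= B) -> `|avgs N s f x| <= B.
Proof.
move=> fB; elim: s x => //= g s IH x.
rewrite /avg normrM ger0_norm ?invr_ge0 ?ler0n// mulrC ler_pdivrMr ?ltr0n//.
apply: le_trans (ler_norm_sum _ _ _) _.
apply: le_trans (ler_sum _ (fun i _ => IH _)) _.
by rewrite sumr_const card_ord mulr_natr.
Qed.

Hypothesis mulGC : forall x y : G, (x * y = y * x)%g.

Lemma avgs_translate N s h f x :
  avgs N s (fun y => f (h * y)%g) x = avgs N s f (h * x)%g.
Proof.
elim: s x => //= g s IH x; rewrite /avg; congr (_ * _).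
by apply: eq_bigr => i _; rewrite IH !mulgA (mulGC h).
Qed.

(* The average over the powers of [h] telescopes. *)
Lemma avgs_almost_invariant N s h f (B : R) x :
  h \in s -> (forall y, `|f y| <= B) ->
  `|avgs N s (fun y => f (h^-1 * y)%g) x - avgs N s f x| <= (B + B) / N.+1%:R.
Proof.
move=> + fB; elim: s x => //= g s IH x; rewrite inE => /predU1P[<-|/IH {}IH].
  under [avg _ _ (avgs _ _ _)]funext => y.
    rewrite /avg; under eq_bigr => i _ do rewrite avgs_translate.
    over.
  rewrite /avg -mulrBr normrM ger0_norm ?invr_ge0 ?ler0n// mulrC.
  rewrite ler_wpM2r ?invr_ge0 ?ler0n// -sumrB.
  set F := avgs N s f.
  have -> n : \sum_(i < n.+1) (F (h^-1 * (h ^+ i * x))%g - F (h ^+ i * x)%g) =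
      F (h^-1 * x)%g - F (h ^+ n * x)%g.
    elim: n => [|n IHn]; first by rewrite big_ord1 !expg0 mul1g.
    rewrite big_ord_recr/= IHn expgS -!mulgA (mulgA h^-1%g) mulVg mul1g.
    by rewrite addrA subrK.
  by apply: le_trans (ler_normB _ _) _; apply: lerD; exact: avgs_bound.
(* When [h] lies in the tail, the difference is itself an average along [g] of the differences for
   the tail, so [avgs_bound] carries over the induction bound. *)
have -> : avg N g (avgs N s (fun y => f (h^-1 * y)%g)) x -
  avg N g (avgs N s f) x = avgs N [:: g]
   (fun y => avgs N s (fun y => f (h^-1 * y)%g) y - avgs N s f y) x.
  by rewrite /= /avg -mulrBr -sumrB.
by apply: avgs_bound.
Qed.

Lemma abelian_amenable : amenable R G.
Proof.
(* Boxes are directed by enlarging both the side length and the list of directions. [B p] is the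
   tail above [p], and an ultrafilter refining all tails defines the limit. *)
pose B (p : nat * seq G) := [set q : nat * seq G | (p.1 <= q.1)%N /\ {subset p.2 <= q.2}].
have BF : ProperFilter (filter_from setT B).
  apply: filter_from_proper; last by move=> p _; exists p; split.
  apply: filter_fromT_filter; first by exists (0%N, [::]).
  move=> [M s] [N t]; exists (maxn M N, s ++ t) => -[K u] [/= MNK stu].
  rewrite geq_max in MNK; case/andP: MNK => MK NK.
  by split; split=> //= x xs; apply: stu; rewrite mem_cat xs ?orbT.
have [U [UU BU]] := ultraFilterLemma BF.
have UF := @ultra_proper _ _ UU.
pose a f (p : nat * seq G) : R^o := avgs p.1 p.2 f 1%g.
have ac f : bounded_fun f -> cvg (a f @ U).
  move=> /bounded_funP[C fC]; apply: cvg_ultra_bounded => //.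
  by apply/bounded_funP; exists C => p; exact: avgs_bound.
exists (fun f => lim (a f @ U)); split.
- move=> b c f f' bf bf'; apply/cvg_lim => //.
  rewrite [X in X @ _](_ : _ = fun p => b * a f p + c * a f' p); last first.
    by apply/funext => p; exact: avgs_linear.
  by apply: cvgD; apply: cvgMr; apply: ac.
- move=> f bf f0; apply: limr_ge; first exact: ac.
  by apply: filterE => p; exact: avgs_ge0.
- apply/cvg_lim => //; rewrite [X in X @ _](_ : _ = fun=> 1); first exact: cvg_cst.
  by apply/funext => p; exact: avgs_cst.
- move=> h f bf.
  have bfh : bounded_fun (fun x => f (h^-1 * x)%g).
    by case/bounded_funP: bf => C fC; apply/bounded_funP; exists C.
  apply/eqP; rewrite -subr_eq0; apply/eqP.
  rewrite -limB; [|exact: ac|exact: ac].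
  apply/cvg_lim => //; apply/cvgr0Pnorm_le => e e0.
  case/bounded_funP: bf => C fC.
  (* With this [N] the bound [(C + C) / M.+1] is at most [e] for all [M >= N], and in the tail above
     [(N, [:: h])] the element [h] is always a direction of the box. *)
  have [N Ne] : exists N : nat, (C + C) / e < N.+1%:R.
    by exists (Num.truncn ((C + C) / e)); exact: truncnS_gt.
  apply: BU; exists (N, [:: h]) => // -[M s] [/= NM hs].
  apply: le_trans (avgs_almost_invariant _ _ _ fC) _.
    by apply: hs; rewrite mem_head.
  rewrite ler_pdivrMr ?ltr0n// mulrC -ler_pdivrMr//.
  by apply: le_trans (ltW Ne) _; rewrite ler_nat.
Qed.

End Average.

(** * Amenability of group extensions *)

Lemma left_invariant_mean_bound (R : realType) (G : groupType)
    (m : (G -> R^o) -> R) (f : G -> R^o) (B : R) :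
  left_invariant_mean m -> (forall x, `|f x| <= B) -> `|m f| <= B.
Proof.
move=> [mL m0 m1 _] fB.
have b1 : bounded_fun ((fun=> 1) : G -> R^o).
  by apply/bounded_funP; exists 1 => x; rewrite normr1.
have bf : bounded_fun f by apply/bounded_funP; exists B.
have bc c d : bounded_fun (fun x => c * 1 + d * f x : R^o).
  apply/bounded_funP; exists (`|c| + `|d| * B) => x.
  rewrite mulr1; apply: le_trans (ler_normD _ _) _.
  by rewrite lerD2l normrM ler_wpM2l.
(* Positivity of the mean is applied to the nonnegative functions [B + f] and [B - f], that is, to
   [b] equal to [1] and [-1]. *)
have key (b : R) : `|b| = 1 -> 0 <= B * 1 + b * m f.
  move=> nb; rewrite -m1 -mL//; apply: m0 => // x.
  rewrite mulr1 -[b * f x]opprK subr_ge0; apply: le_trans (ler_norm _) _.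
  by rewrite normrN normrM nb mul1r.
have := key 1 (normr1 R); have := key (-1) (normrN1 R).
by rewrite ler_norml => *; apply/andP; split; lra.
Qed.

Lemma multiplicative1 (G H : groupType) (f : {multiplicative G -> H}) :
  f 1%g = 1%g.
Proof. by apply: (@mulgI _ (f 1%g)); rewrite -gmulfM !mulg1. Qed.

Lemma multiplicativeV (G H : groupType) (f : {multiplicative G -> H}) x :
  f x^-1%g = (f x)^-1%g.
Proof.
by apply: (@mulgI _ (f x)); rewrite -gmulfM !mulgV multiplicative1.
Qed.

(** With a section [s] of [p], the fibre over [k] is the coset of [s k] by the image of [i]. The
    mean of [f] is taken by [mN] along each fibre, giving [F f], and then by [mK] over the
    fibres. *)
Lemma amenable_extension (R : realType) (N G K : groupType)
    (i : {multiplicative N -> G}) (p : {multiplicative G -> K}) :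
  (forall k, exists g, p g = k) ->
  (forall g, p g = 1%g -> exists n, i n = g) ->
  (forall n, p (i n) = 1%g) ->
  amenable R N -> amenable R K -> amenable R G.
Proof.
move=> psurj kerp pi1 [mN HN] [mK HK].
have /choice[s ps] := psurj.
pose F (f : G -> R^o) k : R^o := mN (fun n => f (s k * i n)%g).
have bN (f : G -> R^o) k : bounded_fun f -> bounded_fun (fun n => f (s k * i n)%g).
  by move=> /bounded_funP[B fB]; apply/bounded_funP; exists B.
have bF (f : G -> R^o) : bounded_fun f -> bounded_fun (F f).
  move=> /bounded_funP[B fB]; apply/bounded_funP; exists B => k.
  exact: left_invariant_mean_bound HN _.
have [NL N0 N1 NT] := HN; have [KL K0 K1 KT] := HK.
exists (fun f => mK (F f)); split.
- move=> a b f g bf bg; rewrite -KL; [|exact: bF..].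
  by congr mK; apply/funext => k; rewrite /F NL//; exact: bN.
- by move=> f bf f0; apply: K0 => [|k]; [exact: bF|apply: N0 => //; exact: bN].
- by rewrite (_ : F _ = fun=> 1)//; apply/funext => k; exact: N1.
- move=> g f bf; rewrite -(KT (p g) (F f)); last exact: bF.
  congr mK; apply/funext => k; rewrite /F.
  set k' := ((p g)^-1 * k)%g.
  (* Translation by [g^-1] maps the fibre over [k] to the one over [k'], but sends [s k] to
     [s k' * i n] instead of [s k']. Left invariance of [mN] absorbs [n]. *)
  have [n nE] : exists n, i n = ((s k')^-1 * (g^-1 * s k))%g.
    by apply: kerp; rewrite !gmulfM !multiplicativeV !ps mulVg.
  rewrite -(NT n^-1%g (fun x => f (s k' * i x)%g)); last exact: bN.
  congr mN; apply/funext => x.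
  by rewrite invgK gmulfM nE !mulgA mulgV mul1g.
Qed.

(** * The wreath product of a group with the integers *)

Section Wreath.
Variable A : groupType.

Definition lamps : Type := int -> A.
HB.instance Definition _ := Choice.on lamps.

Lemma lamps_mulA : associative (fun f g : lamps => (fun i => f i * g i)%g : lamps).
Proof. by move=> f g h; apply/funext => i; rewrite mulgA. Qed.

Lemma lamps_mul1 : left_id ((fun=> 1%g) : lamps) (fun f g i => (f i * g i)%g).
Proof. by move=> f; apply/funext => i; rewrite mul1g. Qed.

Lemma lamps_mulr1 : right_id ((fun=> 1%g) : lamps) (fun f g i => (f i * g i)%g).
Proof. by move=> f; apply/funext => i; rewrite mulg1. Qed.

Lemma lamps_mulV : left_inverse ((fun=> 1%g) : lamps) (fun f i => (f i)^-1%g)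
  (fun f g i => (f i * g i)%g).
Proof. by move=> f; apply/funext => i; rewrite mulVg. Qed.

Lemma lamps_mulrV : right_inverse ((fun=> 1%g) : lamps) (fun f i => (f i)^-1%g)
  (fun f g i => (f i * g i)%g).
Proof. by move=> f; apply/funext => i; rewrite mulgV. Qed.

HB.instance Definition _ := isGroup.Build lamps
  lamps_mulA lamps_mul1 lamps_mulr1 lamps_mulV lamps_mulrV.

(* The unrestricted wreath product: configurations are not required to have
   finite support. *)
Definition wreath : Type := (lamps * int)%type.
HB.instance Definition _ := Choice.on wreath.

(** The semidirect product law: the lamps of [v] are shifted by the cursor of [u] before the
    pointwise product. *)
Definition wreath_mul (u v : wreath) : wreath :=
  (fun i => (u.1 i * v.1 (i - u.2))%g, u.2 + v.2).
Definition wreath_one : wreath := (fun=> 1%g, 0).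
Definition wreath_inv (u : wreath) : wreath :=
  (fun i => (u.1 (i + u.2))^-1%g, - u.2).

Lemma wreath_mulA : associative wreath_mul.
Proof.
move=> u v w; rewrite /wreath_mul/= addrA; congr (_, _).
by apply/funext => i; rewrite mulgA opprD addrA.
Qed.

Lemma wreath_mul1 : left_id wreath_one wreath_mul.
Proof.
move=> [f m]; rewrite /wreath_mul/= add0r; congr (_, _).
by apply/funext => i; rewrite mul1g subr0.
Qed.

Lemma wreath_mulr1 : right_id wreath_one wreath_mul.
Proof.
move=> [f m]; rewrite /wreath_mul/= addr0; congr (_, _).
by apply/funext => i; rewrite mulg1.
Qed.

Lemma wreath_mulV : left_inverse wreath_one wreath_inv wreath_mul.
Proof.
move=> [f m]; rewrite /wreath_mul/= addNr; congr (_, _).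
by apply/funext => i; rewrite opprK mulVg.
Qed.

Lemma wreath_mulrV : right_inverse wreath_one wreath_inv wreath_mul.
Proof.
move=> [f m]; rewrite /wreath_mul/= subrr; congr (_, _).
by apply/funext => i; rewrite subrK mulgV.
Qed.

HB.instance Definition _ := isGroup.Build wreath
  wreath_mulA wreath_mul1 wreath_mulr1 wreath_mulV wreath_mulrV.

Definition wreath_lamps (f : lamps) : wreath := (f, 0).
Definition wreath_pos (u : wreath) : Zm := u.2.
Definition wreath_lamp0 (a : A) : wreath :=
  (fun i => if i == 0 then a else 1%g, 0).
Definition wreath_shift (n : Zm) : wreath := (fun=> 1%g, n).

Lemma wreath_lampsM : {morph wreath_lamps : f g / (f * g)%g}.
Proof.
move=> f g; rewrite /wreath_lamps [RHS]/(_ * _)%g/= /wreath_mul/= addr0.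
by congr (_, _); apply/funext => i; rewrite subr0.
Qed.
HB.instance Definition _ :=
  isMultiplicative.Build lamps wreath wreath_lamps wreath_lampsM.

Lemma wreath_posM : {morph wreath_pos : u v / (u * v)%g}.
Proof. by []. Qed.
HB.instance Definition _ :=
  isMultiplicative.Build wreath Zm wreath_pos wreath_posM.

Lemma wreath_lamp0M : {morph wreath_lamp0 : a b / (a * b)%g}.
Proof.
move=> a b; rewrite /wreath_lamp0 [RHS]/(_ * _)%g/= /wreath_mul/= addr0.
congr (_, _); apply/funext => i; rewrite subr0.
by case: ifP => // _; rewrite mulg1.
Qed.
HB.instance Definition _ :=
  isMultiplicative.Build A wreath wreath_lamp0 wreath_lamp0M.

Lemma wreath_shiftM : {morph wreath_shift : m n / (m * n)%g}.
Proof.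
move=> m n; rewrite /wreath_shift [RHS]/(_ * _)%g/= /wreath_mul/=.
by congr (_, _); apply/funext => i; rewrite mulg1.
Qed.
HB.instance Definition _ :=
  isMultiplicative.Build Zm wreath wreath_shift wreath_shiftM.

Lemma wreath_amenable (R : realType) :
  (forall a b : A, (a * b = b * a)%g) -> amenable R wreath.
Proof.
move=> AC; apply: (@amenable_extension R lamps wreath Zm wreath_lamps wreath_pos).
- by move=> k; exists (wreath_shift k).
- by move=> [f m] m0; exists f; congr (_, _); exact: esym m0.
- by [].
- by apply: abelian_amenable => f g; apply/funext => i; exact: AC.
- by apply: abelian_amenable => m n; exact: addrC.
Qed.

(** * Reading a positive word off its image in the wreath product *)

Definition to_wreath : {multiplicative freeProd A Zm -> wreath} :=
  fp_lift wreath_lamp0 wreath_shift.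

Definition fp_gen : freeProd A Zm := @fp_inr A Zm 1%R.

(* The word [f 0 * c * f 1 * c * ... * c * f k], where [c] is [fp_gen]. *)
Fixpoint decode (f : nat -> A) (k : nat) : freeProd A Zm :=
  if k is k'.+1 then (fp_inl Zm (f 0%N) * fp_gen * decode (fun i => f i.+1) k')%g
  else fp_inl Zm (f 0%N).

Lemma eq_decode f g k : f =1 g -> decode f k = decode g k.
Proof. by move=> /funext ->. Qed.

(** Concatenating two words merges the last block of the first with the first block of the second;
    this is the product in the hypothesis on [h k]. *)
Lemma decodeM f g h k l :
  (forall i, (i < k)%N -> h i = f i) -> h k = (f k * g 0%N)%g ->
  (forall j, h (k + j.+1)%N = g j.+1) ->
  decode h (k + l) = (decode f k * decode g l)%g.
Proof.
elim: k f h => [|k IH] f h hf hk hg.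
  case: l => [|l] /=; rewrite hk gmulfM -?mulgA//.
  by do 3!congr (_ * _)%g; apply: eq_decode => i; exact: hg.
rewrite addSn /= hf// -[RHS]mulgA; congr (_ * _)%g.
by apply: IH => // i ik; exact: hf.
Qed.

Lemma decode1 k : decode (fun=> 1%g) k = fp_inr A (k%:Z : Zm).
Proof.
elim: k => [|k IH] /=; first by rewrite !multiplicative1.
by rewrite IH multiplicative1 mul1g -gmulfM; congr (fp_inr A _).
Qed.

(** The invariant for induction over the submonoid. Its last clause confines the lamps to positions
    [0] to [k], so that in a product the two configurations overlap only at the junction [k]. *)
Definition decodable (x : freeProd A Zm) (f : int -> A) (k : nat) : Prop :=
  [/\ to_wreath x = (f, k%:Z), decode (fun i => f i%:Z) k = x &
      forall i : int, (i < 0) || (k%:Z < i) -> f i = 1%g].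

Lemma decodableM x y f g k l : decodable x f k -> decodable y g l ->
  decodable (x * y)%g (fun i => (f i * g (i - k%:Z))%g) (k + l).
Proof.
move=> [xf fx f1] [yg gy g1]; split.
- by rewrite gmulfM xf yg.
(* Below [k] the shifted [g] is trivial, at [k] both factors contribute, and above [k] the
   configuration [f] is trivial. *)
- rewrite -fx -gy; apply: decodeM => [i ik||j].
  + by rewrite (g1 (i%:Z - k%:Z)) ?mulg1 // subr_lt0 ltz_nat ik.
  + by rewrite subrr.
  + by rewrite f1 ?mul1g; [congr g|]; lia.
- by move=> i ik; rewrite f1 ?g1 ?mul1g//; lia.
Qed.

Lemma fp_submonoid_decodable (S : set A) x :
  fp_submonoid S Nset x -> exists f k, decodable x f k.
Proof.
move: x; suff: fp_submonoid S Nset `<=` [set x | exists f k, decodable x f k] by [].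
apply: smallest_sub; first split.
- exists (fun=> 1%g), 0%N; split => //; first by rewrite multiplicative1.
  by rewrite /= multiplicative1.
- move=> x y [f [k xf]] [g [l yg]].
  by exists (fun i => (f i * g (i - k%:Z))%g), (k + l)%N; exact: decodableM.
(* [Nset] excludes negative powers of the generator, so the cursor ends at a natural number [n]. *)
- move=> _ [[a _ <-]|[[n|//] _ <-]].
  + exists (fun i => if i == 0 then a else 1%g), 0%N; split => //.
      by rewrite [LHS]fp_lift_inl.
    by move=> i i0; case: ifP => // /eqP; lia.
  + exists (fun=> 1%g), n; split => //; last exact: decode1.
    by rewrite [LHS]fp_lift_inr.
Qed.

(** On the submonoid an element is the decoding of its image, so equal images force equal
    elements. *)
Lemma to_wreath_inj (S : set A) :
  {in fp_submonoid S Nset &, injective to_wreath}.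
Proof.
move=> x y /set_mem /fp_submonoid_decodable[f [k [xf fx _]]].
move=> /set_mem /fp_submonoid_decodable[g [l [yg gy _]]] e.
by move: xf; rewrite e yg -fx -gy => -[-> ->].
Qed.

End Wreath.

(** * Strong reduction onto the image of the cone *)

(** The image of the cone serves as the cone of [H]. If [f x] and [f y] are mutually inverse with
    [x] and [y] in the cone, then [x * y] and [1] have the same image, so [x * y = 1] by injectivity
    and [x = 1] by positivity of the cone of [G]. *)
Lemma strongly_reduces_image (R : realType) (G : orderedGroup) (H : groupType)
    (f : {multiplicative G -> H}) :
  amenable R H -> {in cone G &, injective f} ->
  strongly_reduces_to_amenable R G.
Proof.
move=> HA finj; have [[P1 PM] PV] := coneP G.
have fP : positive_cone (f @` cone G).
  split; first split.
  - by exists 1%g => //; exact: multiplicative1.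
  - move=> _ _ [x Px <-] [y Py <-]; exists (x * y)%g; [exact: PM|exact: gmulfM].
  apply/seteqP; split => [_ [[x Px <-] [_ [y Py <-] yx]]|_ ->]; last first.
    split; first by exists 1%g => //; exact: multiplicative1.
    exists 1%g; last exact: invg1.
    by exists 1%g => //; exact: multiplicative1.
  have xy : (x * y)%g = 1%g.
    apply: finj; rewrite ?inE//; first exact: PM.
    by rewrite gmulfM -yx mulVg multiplicative1.
  suff -> : x = 1%g by exact: multiplicative1.
  suff : [set 1%g] x by [].
  rewrite -PV; split => //; exists y => //.
  by apply: (@mulIg _ y); rewrite mulVg xy.
exists (OrderedGroup fP); split => //; exists f; split => //.
by split=> // x Px; exists x.
Qed.

Theorem corollary3p31 (R : realType) :
  strongly_reduces_to_amenable R (@OrderedGroup Z2_Z N2_N N2_N_cone).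
Proof.
apply: (@strongly_reduces_image R (OrderedGroup N2_N_cone) (wreath Z2) (to_wreath Z2)).
  apply: wreath_amenable => -[a b] [a' b'].
  by congr (_, _); exact: addrC.
exact: to_wreath_inj.
Qed.
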